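(* Let $\mathfrak A$ be a class of complete types and let $R:\mathfrak A\to \mathrm{Ord}\cup\{\infty\}$ be a rank. Then $R$ is a dividing rank if and only if $R$ has Weak bounded multiplicity.
   Context: $T$ is a complete first-order theory in a language $L$, with a monster model $\mathfrak C$ that is $\bar\kappa$-saturated and strongly $\bar\kappa$-homogeneous for a sufficiently large cardinal $\bar\kappa$ (e.g. strongly inaccessible). All parameter sets are small subsets of $\mathfrak C$ (cardinality $<\bar\kappa$), and cardinals quantified over in the definitions below are small. Complete types are finitary; $S(A)$ is the set of complete types over $A$; for a complete type $p\in S(A)$, $dom(p)=A$. A class of complete types is a class $\mathfrak A$ of complete types such that: if $p(x)\in\mathfrak A$ and $q(x)\supseteq p(x)$ is a complete type then $q\in\mathfrak A$; and if $p\in\mathfrak A$ and $f\in Aut(\mathfrak C)$ then the conjugate $p^f\in\mathfrak A$. A rank on $\mathfrak A$ is a mapping $R:\mathfrak A\to \mathrm{Ord}\cup\{\infty\}$ with Heredity ($p\subseteq q$ in $\mathfrak A$ implies $R(p)\ge R(q)$) and Isomorphism ($R(p)=R(p^f)$ for all $p\in\mathfrak A$, $f\in Aut(\mathfrak C)$). A type $p$ is ranked by $R$ if $R(p)<\infty$. $R$ is a dividing rank if for all $p\in S(A)$, $q\in S(B)$ in $\mathfrak A$ with $p\subseteq q$, $p$ ranked and $q$ dividing over $A$, one has $R(p)>R(q)$. A collection of types is $k$-inconsistent if the union of any $k$ of its (distinct) members is inconsistent. $R$ has Weak bounded multiplicity if for any ranked $p\in\mathfrak A$, any $k\ge 2$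 and any cardinal $\lambda$, there is a cardinal $\kappa$ such that any $k$-inconsistent collection of complete types $q$ extending $p$ with $|dom(q)|\le\lambda$, all with $R(q)=R(p)$, has cardinality at most $\kappa$. *)

(* Defs.v *)
From mathcomp Require Import all_boot all_order.
From mathcomp Require Import boolp classical_sets cardinality.

Set Implicit Arguments.
Unset Strict Implicit.
Unset Printing Implicit Defensive.

Import Order.TTheory.
Local Open Scope classical_set_scope.
Local Open Scope card_scope.

Record language := Language {
  fsym : Type;
  farity : fsym -> nat;
  rsym : Type;
  rarity : rsym -> nat }.

(* Variables are well-scoped de Bruijn indices: a [form L n] has its free
   variables among n, and [FAll] binds the index [ord0]. *)
Inductive term (L : language) (n : nat) : Type :=
| TVar of 'I_n
| TApp (f : fsym L) of ('I_(farity f) -> term L n).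

Inductive form (L : language) : nat -> Type :=
| FBot n : form L n
| FEq n : term L n -> term L n -> form L n
| FRel n (r : rsym L) : ('I_(rarity r) -> term L n) -> form L n
| FImp n : form L n -> form L n -> form L n
| FAll n : form L n.+1 -> form L n.

Arguments FBot {L n}.

Definition FNot L n (phi : form L n) : form L n := FImp phi FBot.

Definition sentence (L : language) := form L 0.

Record structure (L : language) := Structure {
  carrier :> Type;
  finterp : forall f : fsym L, ('I_(farity f) -> carrier) -> carrier;
  rinterp : forall r : rsym L, ('I_(rarity r) -> carrier) -> Prop;
  carrier_inhabited : inhabited carrier }.

Fixpoint eval L (M : structure L) n (v : 'I_n -> M) (t : term L n) : M :=
  match t with
  | TVar i => v i
  | TApp f ts => finterp (fun j => eval v (ts j))
  end.

Definition scons (X : Type) n (a : X) (v : 'I_n -> X) : 'I_n.+1 -> X :=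
  fun i => if unlift ord0 i is Some j then v j else a.

Fixpoint holds L (M : structure L) n (phi : form L n) : ('I_n -> M) -> Prop :=
  match phi with
  | FBot _ => fun _ => False
  | FEq _ t u => fun v => eval v t = eval v u
  | FRel _ _ ts => fun v => rinterp (fun j => eval v (ts j))
  | FImp _ phi1 phi2 => fun v => holds phi1 v -> holds phi2 v
  | FAll _ phi1 => fun v => forall a : M, holds phi1 (scons a v)
  end.

Definition models L (M : structure L) (T : set (sentence L)) : Prop :=
  forall phi, T phi -> forall v : 'I_0 -> M, holds phi v.

Definition entails L (T : set (sentence L)) (phi : sentence L) : Prop :=
  forall N : structure L, models N T -> forall v : 'I_0 -> N, holds phi v.

Definition complete_theory L (T : set (sentence L)) : Prop :=
  (exists N : structure L, models N T) /\
  (forall phi, entails T phi \/ entails T (FNot phi)).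

Definition automorphism L (M : structure L) (f : M -> M) : Prop :=
  [/\ bijective f,
      forall (g : fsym L) (a : 'I_(farity g) -> M),
        f (finterp a) = finterp (f \o a) &
      forall (r : rsym L) (a : 'I_(rarity r) -> M),
        rinterp a <-> rinterp (f \o a)].

(* The formula phi(x, b), where x is an n-tuple of variables and b a finite
   tuple of parameters, is stored as the pair of phi(x, y) and b. *)
Record pform L (M : structure L) (n : nat) := PForm {
  npar : nat;
  body : form L (n + npar);
  par : 'I_npar -> M }.

Definition pnot L (M : structure L) n (phi : pform M n) : pform M n :=
  PForm (FNot (body phi)) (par (p:=phi)).

Definition pmap L (M : structure L) n (f : M -> M) (phi : pform M n) :
    pform M n :=
  PForm (body phi) (f \o par (p:=phi)).

Definition fcat (X : Type) n m (a : 'I_n -> X) (b : 'I_m -> X) :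
    'I_(n + m) -> X :=
  fun i => match split i with inl j => a j | inr j => b j end.

Definition sat L (M : structure L) n (a : 'I_n -> M) (phi : pform M n) : Prop :=
  holds (body phi) (fcat a (par (p:=phi))).

Definition over L (M : structure L) n (A : set M) (phi : pform M n) : Prop :=
  forall j, A (par (p:=phi) j).

Definition ptype L (M : structure L) (n : nat) := set (pform M n).

Definition realizes L (M : structure L) n (a : 'I_n -> M) (p : ptype M n) :
    Prop :=
  forall phi, p phi -> sat a phi.

(* Consistency with the elementary diagram of M, i.e. finite satisfiability
   in M. *)
Definition consistent L (M : structure L) n (p : ptype M n) : Prop :=
  forall F : ptype M n, finite_set F -> F `<=` p ->
    exists a : 'I_n -> M, realizes a F.

Definition types_over L (M : structure L) (n : nat) (A : set M) :
    set (ptype M n) :=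
  [set p | [/\ forall phi, p phi -> over A phi,
               consistent p &
               forall phi, over A phi -> p phi \/ p (pnot phi)]].

(* For p in S(A), i.e. [types_over A p], this is A: every a in A occurs in p,
   because p decides the formulas having a as a (possibly dummy) parameter. *)
Definition dom L (M : structure L) n (p : ptype M n) : set M :=
  [set a | exists phi, p phi /\ exists j, par (p:=phi) j = a].

Definition tp L (M : structure L) n (a : 'I_n -> M) (A : set M) : ptype M n :=
  [set phi | over A phi /\ sat a phi].

Definition conj_type L (M : structure L) n (f : M -> M) (p : ptype M n) :
    ptype M n :=
  [set pmap f phi | phi in p].

(* A cardinal is represented by a type K of that cardinality; the smaller
   cardinals are those of the sets [X : set K] with [small K X]. *)
Definition small (K U : Type) (X : set U) : Prop := ~~ ([set: K] #<= X).

Definition strong_limit (K : Type) : Prop :=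
  forall X : set K, small K X -> small K [set Y : set K | Y `<=` X].

Definition saturated (K : Type) L (M : structure L) : Prop :=
  forall (n : nat) (A : set M) (p : ptype M n),
    small K A -> types_over A p -> exists a : 'I_n -> M, realizes a p.

Definition elementary_on L (M : structure L) (A : set M) (f : M -> M) : Prop :=
  forall (n : nat) (phi : form L n) (a : 'I_n -> M),
    (forall i, A (a i)) -> (holds phi a <-> holds phi (f \o a)).

Definition strongly_homogeneous (K : Type) L (M : structure L) : Prop :=
  forall (A : set M) (f : M -> M), small K A -> elementary_on A f ->
    exists g : M -> M, automorphism g /\ (forall a, A a -> g a = f a).

(* "Sufficiently large" is read as: an uncountable strong limit cardinal above
   the cardinality of L.  Strongly inaccessible cardinals above |L| qualify. *)
Definition monster (K : Type) L (M : structure L) : Prop :=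
  [/\ ~ countable [set: K] /\ strong_limit K,
      small K [set: fsym L] /\ small K [set: rsym L],
      saturated K M &
      strongly_homogeneous K M].

Definition complete_type (K : Type) L (M : structure L) n (p : ptype M n) :
    Prop :=
  exists A : set M, small K A /\ types_over A p.

(* The union of any k members, with distinct indices in D, is inconsistent. *)
Definition k_inconsistent L (M : structure L) n (k : nat) (I : Type)
    (D : set I) (p : I -> ptype M n) : Prop :=
  forall s : 'I_k -> I, injective s -> (forall j, D (s j)) ->
    ~ consistent (\bigcup_j p (s j)).

Definition formula_divides L (M : structure L) n (phi : pform M n)
    (A : set M) : Prop :=
  exists (k : nat) (b : nat -> 'I_(npar phi) -> M),
    (forall i, tp (b i) A = tp (par (p:=phi)) A) /\
    k_inconsistent k [set: nat] (fun i => [set PForm (body phi) (b i)]).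

(* [q] is meant to be a type over a small set, so that implication can be
   tested on the realizations in the monster model. *)
Definition divides L (M : structure L) n (q : ptype M n) (A : set M) : Prop :=
  exists phi : pform M n,
    (forall a, realizes a q -> sat a phi) /\ formula_divides phi A.

Definition type_class (K : Type) L (M : structure L)
    (AA : forall n, set (ptype M n)) : Prop :=
  [/\ forall n (p : ptype M n), AA n p -> complete_type K p,
      forall n (p q : ptype M n),
        AA n p -> complete_type K q -> p `<=` q -> AA n q &
      forall n (p : ptype M n) f,
        AA n p -> automorphism f -> AA n (conj_type f p)].

Section Rank.
(* The values of a rank lie in a well-ordered type O with a greatest element,
   which plays the role of infinity: O is alpha + {oo} for an arbitrary ordinal
   alpha, and since the types form a set this captures all maps to Ord + {oo}.
   Only the values R n p with p in AA matter. *)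
Context (K : Type) (L : language) (M : structure L).
Context (d : Order.disp_t) (O : tOrderType d).
Context (AA : forall n, set (ptype M n)) (R : forall n, ptype M n -> O).

Definition is_rank : Prop :=
  (forall n (p q : ptype M n), AA p -> AA q -> p `<=` q ->
     (R q <= R p)%O) /\
  (forall n (p : ptype M n) f, AA p -> automorphism f ->
     R p = R (conj_type f p)).

Definition ranked n (p : ptype M n) : Prop := (R p < \top)%O.

Definition dividing_rank : Prop :=
  forall n (A B : set M) (p q : ptype M n),
    small K A -> small K B -> types_over A p -> types_over B q ->
    AA p -> AA q ->
    p `<=` q -> ranked p -> divides q A -> (R q < R p)%O.

Definition weak_bounded_multiplicity : Prop :=
  forall n (p : ptype M n), AA p -> ranked p ->
  forall k : nat, (2 <= k)%N ->
  forall lambda : set K, small K lambda ->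
  exists kappa : set K, small K kappa /\
    forall C : set (ptype M n),
      k_inconsistent k C id ->
      (forall q, C q ->
         [/\ complete_type K q, p `<=` q, dom q #<= lambda & R q = R p]) ->
      C #<= kappa.

End Rank.

(* Main.v *)
Require Import Defs.
From mathcomp Require Import all_boot all_order.
From mathcomp Require Import boolp classical_sets cardinality.
From mathcomp Require Import functions filter wochoice.
Import Defs.

(* Suppose that [q], extending [p] with the same rank, divides over [A = dom p]
   via phi(x, b).  Among the sets S of conjugates of [b] over [A] that contain
   the dividing sequence and keep phi(x, S) k-inconsistent, a maximal one is not
   small: a small S is enlarged by a realization of the formulas over A and S
   that hold of all but finitely many terms of the dividing sequence.
   Conjugating [q] by automorphisms sending [b] to the elements of S then gives
   too many k-inconsistent extensions of [p] of the same rank.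

   Conversely, in a very large k-inconsistent family of extensions of [p] of
   equal rank, pass to a large subfamily of types conjugate over [A] and colour
   each k-subset with a formula witnessing its inconsistency.  An infinite
   homogeneous set, from the Erdos-Rado theorem, makes this formula divide over
   [A], so the members of the subfamily divide over [A]. *)

Set Implicit Arguments.
Unset Strict Implicit.
Unset Printing Implicit Defensive.

Import Order.TTheory.
Local Open Scope classical_set_scope.
Local Open Scope card_scope.

(** * Small cardinals *)

Definition emb (U V : Type) : Prop := exists f : U -> V, injective f.

Lemma emb_trans V U W : emb U V -> emb V W -> emb U W.
Proof. by move=> [f fI] [g gI]; exists (g \o f); exact: inj_comp. Qed.

Lemma card_le_emb (U V : Type) (A : set U) (B : set V) : (A #<= B) <-> emb A B.
Proof.
split=> [/card_leP/injfunPex[f _ fI]|[f fI]].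
  by exists f => x y; apply: fI; rewrite inE.
apply/card_leP/injfunPex; exists f => // x y _ _; exact: fI.
Qed.

Lemma emb_sub (U : Type) (A : set U) : emb A U.
Proof. by exists val; exact: val_inj. Qed.

Lemma emb_setT (U : Type) : emb U [set: U].
Proof. by exists (fun x => exist _ x (in_setT x)) => x y []. Qed.

Lemma emb_cover (U V : Type) (f : U -> V) (Y : set V) :
  Y `<=` range f -> emb Y U.
Proof.
move=> Yf.
have H (y : Y) : exists x, f x = val y.
  by have [x _ E] := Yf _ (set_mem (valP y)); exists x.
case: (choice H) => g gE; exists g => x y /(congr1 f).
by rewrite !gE => /val_inj.
Qed.

(** Zorn's lemma for one-to-one relations [G] between [U] and [V]: a maximal one exhausts at least
    one side, since a pair of unmatched elements could be added to it. *)
Lemma emb_total (U V : Type) : emb U V \/ emb V U.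
Proof.
pose P (G : set (U * V)) := forall a b, G a -> G b -> (a.1 = b.1 <-> a.2 = b.2).
have [F FP Ftot|G [PG Gmax]] := @Zorn_bigcup _ P.
  move=> a b [X FX Xa] [Y FY Yb].
  by case: (Ftot X Y FX FY) => XY;
    [apply: (FP Y FY) => //; exact: XY | apply: (FP X FX) => //; exact: XY].
case: (pselect (forall u, exists v, G (u, v))) => [H|/existsNP[u Hu]].
  left; case: (choice H) => f Gf; exists f => x y fxy.
  by apply/(PG (x, f x) (y, f y)).
case: (pselect (forall v, exists u, G (u, v))) => [H|/existsNP[v Hv]].
  right; case: (choice H) => f Gf; exists f => x y fxy.
  by apply/(PG (f x, x) (f y, y)).
exfalso; apply: (Gmax (G `|` [set (u, v)])).
  split=> [|sub]; first exact: subsetUl.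
  by apply: Hu; exists v; apply: sub; right.
move=> [a1 a2] [b1 b2] /= [Ga|[-> ->]] [Gb|[-> ->]] //; first exact: (PG _ _ Ga Gb).
- split=> E; exfalso; [apply: Hu; exists a2|apply: Hv; exists a1].
  + by rewrite -E.
  + by rewrite -E.
- split=> E; exfalso; [apply: Hu; exists b2|apply: Hv; exists b1].
  + by rewrite E.
  + by rewrite E.
Qed.

(** The embedding is Kuratowski's pair. It bounds a square by a double power set, which a strong
    limit can handle. *)
Lemma emb_diag (U : Type) : emb (U * U) (set (set U)).
Proof.
exists (fun p => [set [set p.1]; [set p.1; p.2]]) => -[a b] [a' b'] /= E.
have H S : (S = [set a] \/ S = [set a; b]) <-> (S = [set a'] \/ S = [set a'; b']).
  by move/predeqP: E => /(_ S).
have aa' : a = a'.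
  have [/(_ (or_introl erefl)) H1 _] := H [set a].
  by case: H1 => /predeqP/(_ a')[_ X]; [rewrite (X erefl)|rewrite (X (or_introl erefl))].
subst a'; congr (_, _).
have [/(_ (or_intror erefl)) H1 _] := H [set a; b].
have [_ /(_ (or_intror erefl)) H2] := H [set a; b'].
have Hb : b = a \/ b = b'.
  by case: H1 => /predeqP/(_ b)[X _]; have := X (or_intror erefl); [left|].
case: Hb => [E1|//]; move: H2; rewrite E1.
by case=> /predeqP/(_ b')[X _]; [rewrite (X (or_intror erefl))|case: (X (or_intror erefl))].
Qed.

Lemma emb_pair (U U' V V' : Type) : emb U U' -> emb V V' -> emb (U * V) (U' * V').
Proof.
by move=> [f fI] [g gI]; exists (fun p => (f p.1, g p.2)) => -[a b] [c d] [/fI-> /gI->].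
Qed.

Lemma inj_image (U V : Type) (f : U -> V) :
  injective f -> injective (fun X : set U => f @` X).
Proof.
by move=> fI X Y E; apply/predeqP => x; rewrite -(image_inj fI) [f @` X]E image_inj.
Qed.

Lemma emb_fun (U V : Type) : emb (U -> V) (set (U * V)).
Proof.
exists (fun f => [set p | f p.1 = p.2]) => f g E; apply/funext => u.
by move/predeqP: E => /(_ (u, f u)) /= [/(_ erefl) -> _].
Qed.

(** Reading past the end gives [None], so the values also determine the length. *)
Lemma emb_seq (U : Type) : emb (seq U) (nat -> option U).
Proof.
exists (fun s i => nth None (map Some s) i) => s t E.
elim: s t E => [|x s IHs] [|y t] E //.
- by move/(congr1 (@^~ 0)): E.
- by move/(congr1 (@^~ 0)): E.
- congr (_ :: _); first by move/(congr1 (@^~ 0)): E => -[].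
  by apply: IHs; apply/funext => i; move/(congr1 (@^~ i.+1)): E.
Qed.

Lemma emb_option (U : Type) : emb (option U) (set U).
Proof.
exists (fun o => [set x | o = Some x]) => -[x|] [y|] // /predeqP E.
- by have [/(_ erefl) -> _] := E x.
- by have [/(_ erefl)] := E x.
- by have [_ /(_ erefl)] := E y.
Qed.

Lemma emb_sum (U V : Type) : emb (U + V) (set U * set V).
Proof.
exists (fun o => ([set x | o = inl x], [set x | o = inr x])).
move=> [x|x] [y|y] // [/predeqP E /predeqP F].
- by have [/(_ erefl) -> _] := E x.
- by have [/(_ erefl)] := E x.
- by have [/(_ erefl)] := F x.
- by have [/(_ erefl) -> _] := F x.
Qed.

Section SmallTypes.
Variable K : Type.
Hypotheses (Kunc : ~ countable [set: K]) (Klim : strong_limit K).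

Definition smallT (U : Type) := ~ emb K U.

Lemma smallP (U : Type) (X : set U) : small K X <-> smallT X.
Proof.
split=> [/negP nX KX|nX]; last apply/negP => /card_le_emb KX; last apply: nX.
  by apply: nX; apply/card_le_emb; apply: emb_trans KX; exact: emb_sub.
exact: emb_trans (emb_setT _) KX.
Qed.

Lemma smallT_emb (U V : Type) : emb U V -> smallT V -> smallT U.
Proof. by move=> UV nV /emb_trans/(_ UV). Qed.

Lemma smallT_small (U : Type) : smallT U <-> small K [set: U].
Proof.
rewrite smallP; split; apply: smallT_emb; [exact: emb_sub|exact: emb_setT].
Qed.

Lemma smallT_nat : smallT nat.
Proof. by apply/smallT_small/negP. Qed.

Lemma smallT_into (U : Type) : smallT U -> emb U K.
Proof. by case: (emb_total U K). Qed.

(** [strong_limit] speaks of subsets of [K], so [U] is first carried into [K]. *)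
Lemma smallT_set (U : Type) : smallT U -> smallT (set U).
Proof.
move=> sU; have [f fI] := smallT_into sU.
have sR : smallT (range f).
  apply: smallT_emb sU; apply: (emb_cover (f := f)); exact: subset_refl.
move/smallP: sR => /Klim/smallP; apply: smallT_emb.
have sub (X : set U) : f @` X \in [set Y : set K | Y `<=` range f].
  by rewrite inE => _ [x _ <-]; exists x.
exists (fun X => exist (fun Y : set K => Y \in _) _ (sub X)) => X Y /(congr1 val).
exact: inj_image.
Qed.

(** The product is bounded by the square of the larger factor, and that square by a double power
    set. *)
Lemma smallT_prod (U V : Type) : smallT U -> smallT V -> smallT (U * V).
Proof.
move=> sU sV; case: (emb_total U V) => UV.
- apply: (smallT_emb (V := V * V)); first by apply: emb_pair => //; exists id.
  by apply: smallT_emb (emb_diag V) _; do 2!apply: smallT_set.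
- apply: (smallT_emb (V := U * U)); first by apply: emb_pair => //; exists id.
  by apply: smallT_emb (emb_diag U) _; do 2!apply: smallT_set.
Qed.

Lemma smallT_fun (U V : Type) : smallT U -> smallT V -> smallT (U -> V).
Proof.
by move=> sU sV; apply: smallT_emb (emb_fun U V) _; apply/smallT_set/smallT_prod.
Qed.

Lemma smallT_option (U : Type) : smallT U -> smallT (option U).
Proof. by move=> sU; apply: smallT_emb (emb_option U) _; exact: smallT_set. Qed.

Lemma smallT_seq (U : Type) : smallT U -> smallT (seq U).
Proof.
move=> sU; apply: smallT_emb (emb_seq U) _.
by apply: smallT_fun smallT_nat _; exact: smallT_option.
Qed.

Lemma smallT_sum (U V : Type) : smallT U -> smallT V -> smallT (U + V).
Proof.
move=> sU sV; apply: smallT_emb (emb_sum U V) _.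
by apply: smallT_prod; exact: smallT_set.
Qed.

Lemma smallT_ord (n : nat) : smallT 'I_n.
Proof. by apply: smallT_emb smallT_nat; exists val; exact: val_inj. Qed.

Lemma small_cover (U V : Type) (f : U -> V) (Y : set V) :
  smallT U -> Y `<=` range f -> small K Y.
Proof. by move=> sU /emb_cover YU; apply/smallP; exact: smallT_emb YU sU. Qed.

Lemma small_setU (U : Type) (X Y : set U) :
  small K X -> small K Y -> small K (X `|` Y).
Proof.
move=> /smallP sX /smallP sY.
apply: (small_cover (f := fun z : X + Y => match z with inl x => val x | inr y => val y end)).
  exact: smallT_sum.
move=> z [Xz|Yz]; first by exists (inl (exist _ z (mem_set Xz))).
by exists (inr (exist _ z (mem_set Yz))).
Qed.

(** [K] may be a singular strong limit, so smallness of each [F i] alone would not suffice; [V]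
    bounds all of them at once. *)
Lemma small_bigcup (I U : Type) (D : set I) (F : I -> set U) (V : Type)
    (g : I -> V -> U) :
  small K D -> smallT V -> (forall i, D i -> F i `<=` range (g i)) ->
  small K (\bigcup_(i in D) F i).
Proof.
move=> /smallP sD sV FV.
apply: (small_cover (f := fun z : D * V => g (val z.1) z.2)); first exact: smallT_prod.
by move=> u [i Di /(FV i Di)[v _ <-]]; exists (exist _ i (mem_set Di), v).
Qed.

End SmallTypes.

(** * The Erdos-Rado theorem *)

Lemma wf_linear_order (X : Type) :
  exists lt : X -> X -> Prop,
    [/\ well_founded lt, forall x y z, lt x y -> lt y z -> lt x z &
        forall x y, [\/ lt x y, x = y | lt y x]].
Proof.
have [R wR] := well_ordering_principle {classic X}.
have cR : wo_chain R predT by move=> A _; exact: wR.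
have Rtot x y : R x y || R y x by apply: (wo_chainW cR).
have Ranti x y : R x y -> R y x -> x = y.
  by move=> xy yx; apply: (wo_chain_antisymmetric cR) => //; rewrite xy yx.
pose lt (x y : X) : Prop := ~ R y x.
have wf : well_founded lt.
  move=> x; apply: contrapT => nx.
  have [|z [[/asboolP nz zmin] _]] :=
    wR [pred y : {classic X} | `[< ~ Acc lt y >]]; first by exists x; apply/asboolP.
  apply: nz; constructor => y yz; apply: contrapT => ny.
  by apply: yz; apply: zmin; apply/asboolP.
have irr x : ~ lt x x by apply; have := Rtot x x; rewrite orbb.
have tri x y : [\/ lt x y, x = y | lt y x].
  have [xy|nxy] := boolP (R x y); last by constructor 3; apply/negP.
  have [yx|nyx] := boolP (R y x); last by constructor 1; apply/negP.
  by constructor 2; exact: Ranti.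
exists lt; split=> // x y z xy yz; case: (tri x z) => //.
- move=> E; subst z; exfalso.
  by case/orP: (Rtot x y).
- move=> zx; exfalso.
  (* The remaining case is a three-cycle z < x < y < z, excluded by induction on accessibility. *)
  have acyc : forall w, Acc lt w -> forall u v, lt u w -> lt v u -> lt w v -> False.
    move=> w; elim=> {}w _ IH u v uw vu wv.
    exact: (IH _ uw v w vu wv uw).
  exact: (acyc _ (wf z) y x).
Qed.

(** * The ramification tree of a colouring *)

Section Tree.
Variables (X mu : Type) (k : nat) (c : set X -> mu) (lt : X -> X -> Prop).
Hypothesis lt_wf : well_founded lt.
Hypothesis lt_trans : forall x y z, lt x y -> lt y z -> lt x z.
Hypothesis lt_tri : forall x y, [\/ lt x y, x = y | lt y x].

Definition below_body x (rec : forall y, lt y x -> set X) : set X :=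
  [set y | exists yx : lt y x, forall t : 'I_k -> X,
     (forall j, rec y yx (t j)) -> c (y |` range t) = c (x |` range t)].

(* [below x] is the branch under x of the ramification tree: y lies under x
   when y < x and y, x get the same colour over every k-tuple lying under y. *)
Definition below : X -> set X := Fix lt_wf (fun=> set X) below_body.

Lemma belowE x y : below x y <-> lt y x /\
  forall t : 'I_k -> X, (forall j, below y (t j)) ->
    c (y |` range t) = c (x |` range t).
Proof.
rewrite /below Fix_eq => [|z f g fg]; last first.
  by congr below_body; do 2!apply: functional_extensionality_dep => ?.
by split=> [[yx H]|[yx H]] //; exists yx.
Qed.

Lemma lt_irr x : ~ lt x x.
Proof. by elim: (lt_wf x) => y _ IH lt_yy; exact: (IH y). Qed.

Lemma below_lt x y : below x y -> lt y x.
Proof. by case/belowE. Qed.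

Lemma below_trans x y z : below y z -> below x y -> below x z.
Proof.
elim: (lt_wf z) x y => {}z _ IH x y yz xy; apply/belowE; split.
  exact: lt_trans (below_lt yz) (below_lt xy).
move=> t tz; case/belowE: (yz) => _ /(_ t tz) ->.
by case/belowE: (xy) => _; apply=> j; exact: IH (below_lt (tz j)) _ _ (tz j) yz.
Qed.

(** Both y and z have the colours of x over a tuple under y; the induction shows that such a tuple
    also lies under z. *)
Lemma below_chain x y z : below x y -> below x z -> lt y z -> below z y.
Proof.
elim: (lt_wf y) => {}y _ IH xy xz yz; apply/belowE; split=> // t ty.
case/belowE: (xy) => _ /(_ t ty) ->; symmetry.
case/belowE: (xz) => _; apply=> j.
have yt := below_lt (ty j).
by apply: IH => //; [exact: below_trans (ty j) xy|exact: lt_trans yz].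
Qed.

(** Otherwise the smaller of the two would lie under the larger and hence, the branches being equal,
    under itself. *)
Lemma below_inj x y : below x = below y ->
  (forall t : 'I_k -> X, (forall j, below x (t j)) ->
    c (x |` range t) = c (y |` range t)) -> x = y.
Proof.
move=> E H; case: (lt_tri x y) => // xy; exfalso.
- apply: (@lt_irr x); apply: below_lt; rewrite {1}E; apply/belowE; split=> //.
- apply: (@lt_irr y); apply: below_lt; rewrite -{1}E; apply/belowE; split=> // t ty.
  by symmetry; apply: H; rewrite E.
Qed.

Section Code.
Variables (W : Type) (e : X -> X -> option W).
Hypothesis e_inj : forall x u v, below x u -> below x v -> e x u = e x v -> u = v.

(** The branch under x up to isomorphism: with its elements labelled by [e x], the code records the
    labels used, their order, and the colour of x over each labelled k-tuple. No element of [X] is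
    mentioned, so the number of codes depends only on [W], [mu] and k. *)
Definition code (x : X) :
    set (option W + option W * option W + ('I_k -> option W) * mu) :=
  fun d => match d with
  | inl (inl w) => exists2 u, below x u & e x u = w
  | inl (inr (w, w')) => exists u v, [/\ below x u, below x v, lt u v, e x u = w & e x v = w']
  | inr (f, m) => exists t, [/\ forall j, below x (t j), e x \o t = f & c (x |` range t) = m]
  end.

(** Equal codes match the two branches label by label. By induction u and v have the same elements
    under them, and they take the colours of x and y over tuples with the same labels, so
    [below_inj] applies. *)
Lemma code_below x y u v : code x = code y -> below x u -> below y v ->
  e x u = e y v -> u = v.
Proof.
move=> E; have {}E d : code x d <-> code y d by rewrite E.
elim: (lt_wf u) v => {}u _ IH v xu yv uv.
have sub z : below u z -> below v z.
  move=> uz; have xz := below_trans uz xu.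
  have [/(_ (ex_intro2 _ _ z xz erefl))[z' yz' zz'] _] := E (inl (inl (e x z))).
  have zE := IH z (below_lt uz) z' xz yz' (esym zz'); subst z'.
  apply: (below_chain yz' yv).
  have [+ _] := E (inl (inr (e x z, e x u))).
  case=> [|z1 [u1 [yz1 yu1 lt1 zE uE]]]; first by exists z, u; split=> //; exact: below_lt.
  rewrite uv in uE; rewrite -zz' in zE.
  by rewrite -(e_inj yz1 yz' zE) -(e_inj yu1 yv uE).
have sub' z : below v z -> below u z.
  move=> vz; have yz := below_trans vz yv.
  have [_ /(_ (ex_intro2 _ _ z yz erefl))[z' xz' zz']] := E (inl (inl (e y z))).
  have ltz : lt z' u.
    have [_ +] := E (inl (inr (e y z, e y v))).
    case=> [|z1 [u1 [xz1 xu1 lt1 zE uE]]]; first by exists z, v; split=> //; exact: below_lt.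
    rewrite -uv in uE; rewrite -zz' in zE.
    by rewrite -(e_inj xz1 xz' zE) -(e_inj xu1 xu uE).
  have zE := IH z' ltz z xz' yz zz'; subst z'.
  exact: below_chain xz' xu ltz.
apply: below_inj => [|t tu]; first by apply/predeqP => z; split; [exact: sub|exact: sub'].
have tx j : below x (t j) by exact: below_trans (tu j) xu.
have [+ _] := E (inr (e x \o t, c (x |` range t))).
case=> [|t' [ty' et ct]]; first by exists t.
have tE : t' = t.
  apply/funext => j; symmetry; apply: (IH _ (below_lt (tu j))) => //.
  by move/(congr1 (@^~ j)): et => /= ->.
subst t'; case/belowE: (xu) => _ /(_ t tu) ->; rewrite -ct.
by case/belowE: (yv) => _ H; symmetry; apply: H => j; exact: sub.
Qed.

Lemma code_inj : injective code.
Proof.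
move=> x y E; have Ed d : code x d <-> code y d by rewrite E.
have bE : below x = below y.
  apply/predeqP => z; split=> bz.
  - have [/(_ (ex_intro2 _ _ z bz erefl))[z' bz' zz'] _] := Ed (inl (inl (e x z))).
    by rewrite (code_below E bz bz' (esym zz')).
  - have [_ /(_ (ex_intro2 _ _ z bz erefl))[z' bz' zz']] := Ed (inl (inl (e y z))).
    by rewrite -(code_below E bz' bz zz').
apply: below_inj => // t tx.
have [+ _] := Ed (inr (e x \o t, c (x |` range t))).
case=> [|t' [ty' et ct]]; first by exists t.
rewrite -ct; suff -> : t' = t by [].
apply/funext => j; symmetry; apply: (code_below E) => //.
by move/(congr1 (@^~ j)): et => /= ->.
Qed.

End Code.
End Tree.

Lemma ord_lt_max (X : Type) (lt : X -> X -> Prop) n (f : 'I_n.+1 -> X) :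
  well_founded lt -> (forall x y z, lt x y -> lt y z -> lt x z) ->
  (forall x y, [\/ lt x y, x = y | lt y x]) ->
  exists i, forall j, f j = f i \/ lt (f j) (f i).
Proof.
move=> wf tr tri.
have H (s : seq 'I_n.+1) : exists i, forall j, j \in ord0 :: s -> f j = f i \/ lt (f j) (f i).
  elim: s => [|i s [i0 Hi0]]; first by exists ord0 => j; rewrite !inE => /eqP->; left.
  have i00 := Hi0 ord0 (mem_head _ _).
  case: (tri (f i) (f i0)) => [lti|Ei|lti].
  - exists i0 => j; rewrite !inE orbCA => /orP[/eqP->|js]; first by right.
    by apply: Hi0; rewrite inE.
  - exists i0 => j; rewrite !inE orbCA => /orP[/eqP->|js]; first by left.
    by apply: Hi0; rewrite inE.
  - exists i => j; rewrite !inE orbCA => /orP[/eqP->|js]; first by left.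
    by right; have [->//|/tr] := Hi0 j ltac:(by rewrite inE); apply.
have [i Hi] := H (enum 'I_n.+1); exists i => j; apply: Hi.
by rewrite inE mem_enum orbT.
Qed.

Section ErdosRado.
Variable K : Type.
Hypotheses (Kunc : ~ countable [set: K]) (Klim : strong_limit K).

Lemma nat_emb (X : Type) : ~ emb X nat -> emb nat X.
Proof. by case: (emb_total X nat). Qed.

(** Induction on k. On a branch of the ramification tree the colour of k+1 elements does not depend
    on the largest one, so a long branch reduces the problem to k-subsets. Sets are coloured, not
    tuples, so the order of the elements is irrelevant. *)
Lemma erdos_rado (k : nat) (mu : Type) : smallT K mu ->
  exists2 W : Type, smallT K W & forall X : Type, ~ emb X W ->
    forall c : set X -> mu, exists (h : nat -> X) (v : mu),
      injective h /\
      forall s : 'I_k -> nat, injective s -> c (range (h \o s)) = v.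
Proof.
move=> smu; elim: k => [|k [W sW IH]].
  exists nat; first exact: smallT_nat.
  move=> X /nat_emb[h hI] c; exists h, (c set0); split=> // s _; congr c.
  by apply/predeqP => x; split=> // -[[]].
exists (set (option W + option W * option W + ('I_k -> option W) * mu)).
  have sO := smallT_option Klim sW.
  apply/smallT_set => //; apply/smallT_sum => //; first by apply/smallT_sum => //; exact: smallT_prod.
  by apply/smallT_prod => //; apply/smallT_fun => //; exact: smallT_ord.
move=> X nX c; have [lt [lt_wf lt_tr lt_tri]] := wf_linear_order X.
pose bel := below k c lt_wf.
(* If every branch embedded in [W], these embeddings would serve as labels and [code] would embed
   [X] into the bound chosen above. *)
have [x nx] : exists x, ~ emb (bel x) W.
  apply: contrapT => /forallNP/(_ _)/contrapT H.
  pose f x := sval (cid (H x)); apply: nX.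
  have fI x : injective (f x) by exact: svalP (cid (H x)).
  pose e x u := if pselect (bel x u) is left xu then Some (f x (exist _ u (mem_set xu))) else None.
  exists (code c lt_wf e); apply: code_inj => // x u v xu xv; rewrite /e.
  case: pselect => // ?; case: pselect => // ?.
  by case=> /fI/(congr1 val).
(* The point x stands in for the largest element of a (k+1)-subset of its branch. *)
have [h [v [hI hv]]] := IH _ nx (fun S => c (x |` [set val z | z in S])).
exists (val \o h), v; split=> [|s sI]; first exact: inj_comp val_inj hI.
(* At [i0] sits the largest of the k+1 elements; the others lie under it, so exchanging it for x
   preserves the colour. *)
have [i0 Hi0] := ord_lt_max (val \o h \o s) lt_wf lt_tr lt_tri.
rewrite -(hv (s \o lift i0)); last by apply: inj_comp sI _; exact: lift_inj.
pose t j := val (h (s (lift i0 j))).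
have -> : range (val \o h \o s) = val (h (s i0)) |` range t.
  apply/predeqP => z; split=> [[i _ <-]|[->|[j _ <-]]].
  - by case: (unliftP i0 i) => [j|] ->; [right; exists j|left].
  - by exists i0.
  - by exists (lift i0 j).
have -> : [set val z | z in range (h \o (s \o lift i0))] = range t.
  apply/predeqP => z; split=> [[_ [j _ <-] <-]|[j _ <-]]; first by exists j.
  by exists (h (s (lift i0 j))) => //; exists j.
have bx n : bel x (val (h n)) by exact: set_mem (valP (h n)).
have /belowE[_] := bx (s i0); apply=> j.
apply: below_chain (bx _) (bx _) _ => //.
case: (Hi0 (lift i0 j)) => // /val_inj/hI/sI/eqP.
by rewrite eq_sym (negPf (neq_lift _ _)).
Qed.

End ErdosRado.

(** * Counting formulas *)

Section Codes.
Variable L : language.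

(* A term or formula is coded by the map sending each path from the root of its
   syntax tree to the label found there. *)
Definition label : Type := (nat + nat + (fsym L + rsym L))%type.

Definition node (l : label) (k : nat) (sub : 'I_k -> seq nat -> option label) :
    seq nat -> option label :=
  fun p => match p with
  | [::] => Some l
  | i :: p' => if insub i is Some j then sub j p' else None
  end.

Lemma node_label l l' k k' (s : 'I_k -> _) (s' : 'I_k' -> _) :
  node l s = node l' s' -> l = l'.
Proof. by move/(congr1 (@^~ [::])) => -[]. Qed.

Lemma node_sub l l' k (s s' : 'I_k -> _) : node l s = node l' s' -> s = s'.
Proof.
move=> E; apply/funext => j; apply/funext => p.
by move/(congr1 (@^~ (val j :: p))): E; rewrite /= valK.
Qed.

Fixpoint tcode n (t : term L n) : seq nat -> option label :=
  match t with
  | TVar i => node (inl (inl (val i))) (fun i : 'I_0 => fun=> None)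
  | TApp f ts => node (inr (inl f)) (fun j => tcode (ts j))
  end.

Definition pair2 T (x y : T) : 'I_2 -> T := fun i => if val i is 0 then x else y.

Lemma pair2_inj T (x y x' y' : T) : pair2 x y = pair2 x' y' -> x = x' /\ y = y'.
Proof.
by move=> E; split; [move/(congr1 (@^~ ord0)): E|move/(congr1 (@^~ ord_max)): E].
Qed.

Fixpoint fcode n (phi : form L n) : seq nat -> option label :=
  match phi with
  | FBot _ => node (inl (inr 0)) (fun i : 'I_0 => fun=> None)
  | FEq _ t u => node (inl (inr 1)) (pair2 (tcode t) (tcode u))
  | FRel _ r ts => node (inr (inr r)) (fun j => tcode (ts j))
  | FImp _ phi1 phi2 => node (inl (inr 2)) (pair2 (fcode phi1) (fcode phi2))
  | FAll _ phi1 => node (inl (inr 3)) (fun i : 'I_1 => fcode phi1)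
  end.

Lemma tcode_inj n : injective (@tcode n).
Proof.
elim=> [i|f ts IH] [j|g us] E; have := node_label E => // -[].
  by move/val_inj->.
move=> fg; subst g; congr TApp; apply/funext => j; apply: IH.
by move/node_sub/(congr1 (@^~ j)): E.
Qed.

Lemma fcode_inj n : injective (@fcode n).
Proof.
move=> phi; elim: phi => {n} [n|n t u|n r ts|n p1 IH1 p2 IH2|n p IH] psi.
- by case: n / psi => [n|n t' u'|n r' ts'|n q1 q2|n q] // E; have := node_label E.
- move: t u.
  case: n / psi => [n|n t' u'|n r' ts'|n q1 q2|n q] t u E; have := node_label E => // _.
  by have [/tcode_inj-> /tcode_inj->] := pair2_inj (node_sub E).
- move: ts.
  case: n / psi => [n|n t' u'|n r' ts'|n q1 q2|n q] ts E; have := node_label E => // -[].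
  move=> rr; subst r'; congr FRel; apply/funext => j; apply: tcode_inj.
  by move/node_sub/(congr1 (@^~ j)): E.
- move: p1 IH1 p2 IH2.
  case: n / psi => [n|n t' u'|n r' ts'|n q1 q2|n q] p1 IH1 p2 IH2 E; have := node_label E => // _.
  by have [/IH1-> /IH2->] := pair2_inj (node_sub E).
- move: p IH.
  case: n / psi => [n|n t' u'|n r' ts'|n q1 q2|n q] p IH E; have := node_label E => // _.
  by move/node_sub/(congr1 (@^~ ord0)): E => /IH->.
Qed.

End Codes.

(** A formula whose parameters are names in [P]. Templates can be counted, and one template can be
    read in several parameter sets through different maps [e]. *)
Record template (L : language) (n : nat) (P : Type) := Template {
  tnpar : nat;
  tbody : form L (n + tnpar);
  tpar : 'I_tnpar -> P }.

Definition inst L (M : structure L) n P (e : P -> M) (g : template L n P) :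
    pform M n :=
  PForm (tbody g) (e \o tpar (t:=g)).

Section SmallTemplates.
Variable K : Type.
Hypotheses (Kunc : ~ countable [set: K]) (Klim : strong_limit K).

Lemma smallT_template L n P : smallT K (fsym L) -> smallT K (rsym L) ->
  smallT K P -> smallT K (template L n P).
Proof.
move=> sf sr sP.
pose par (g : template L n P) : nat -> option P :=
  fun i => if insub i is Some j then Some (tpar (t:=g) j) else None.
apply: (smallT_emb (V := (nat * (seq nat -> option (label L))) * (nat -> option P))).
  exists (fun g => (tnpar g, fcode (tbody g), par g)) => -[m b q] [m' b' q'] [mm]; subst m'.
  move=> /= /fcode_inj-> E; congr Template; apply/funext => j.
  by move/(congr1 (@^~ (val j))): E; rewrite /par /= valK => -[].
have snat := smallT_nat Kunc.
apply: smallT_prod => //; last first.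
  by apply: smallT_fun => //; exact: smallT_option.
apply: smallT_prod => //; apply: smallT_fun => //; first exact: smallT_seq.
apply: smallT_option => //; by apply: smallT_sum => //; exact: smallT_sum.
Qed.

End SmallTemplates.

(** * Definable sets and saturation *)

Section Renaming.
Variable L : language.

Definition rlift n m (r : 'I_n -> 'I_m) : 'I_n.+1 -> 'I_m.+1 :=
  fun i => if unlift ord0 i is Some j then lift ord0 (r j) else ord0.

Fixpoint tren n m (r : 'I_n -> 'I_m) (t : term L n) : term L m :=
  match t with
  | TVar i => TVar L (r i)
  | TApp f ts => TApp (fun j => tren r (ts j))
  end.

Fixpoint ren n (phi : form L n) : forall m, ('I_n -> 'I_m) -> form L m :=
  match phi with
  | FBot _ => fun m r => FBot
  | FEq _ t u => fun m r => FEq (tren r t) (tren r u)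
  | FRel _ _ ts => fun m r => FRel (fun j => tren r (ts j))
  | FImp _ phi1 phi2 => fun m r => FImp (ren phi1 r) (ren phi2 r)
  | FAll _ phi1 => fun m r => FAll (ren phi1 (rlift r))
  end.

Lemma scons_rlift (X : Type) n m (r : 'I_n -> 'I_m) (a : X) v :
  scons a v \o rlift r = scons a (v \o r).
Proof.
apply/funext => i; rewrite /scons /rlift /=.
by case: (unlift ord0 i) => [j|]; rewrite ?liftK ?unlift_none.
Qed.

Lemma eval_tren (M : structure L) n m (r : 'I_n -> 'I_m) (v : 'I_m -> M) t :
  eval v (tren r t) = eval (v \o r) t.
Proof. by elim: t => //= f ts IH; congr finterp; apply/funext => j; exact: IH. Qed.

Lemma holds_ren (M : structure L) n (phi : form L n) m (r : 'I_n -> 'I_m)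
    (v : 'I_m -> M) : holds (ren phi r) v = holds phi (v \o r).
Proof.
elim: phi m r v => {n} [n|n t u|n R ts|n p1 IH1 p2 IH2|n p IH] m r v //=.
- by rewrite !eval_tren.
- by congr rinterp; apply/funext => j; rewrite eval_tren.
- by rewrite IH1 IH2.
- by apply/propext; split=> H a; have := H a; rewrite IH scons_rlift.
Qed.

Lemma holds_auto (M : structure L) (f : M -> M) n (phi : form L n) (v : 'I_n -> M) :
  automorphism f -> holds phi (f \o v) <-> holds phi v.
Proof.
move=> [fb ff fr]; have [g fK gK] := fb.
have fe k (t : term L k) w : eval (f \o w) t = f (eval w t).
  elim: t => //= h ts IH; rewrite ff; congr finterp; apply/funext => j; exact: IH.
elim: phi v => {n} [n|n t u|n R ts|n p1 IH1 p2 IH2|n p IH] v //=.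
- by rewrite !fe; split=> [/(bij_inj fb)|->].
- have -> : (fun j => eval (f \o v) (ts j)) = f \o (fun j => eval v (ts j)).
    by apply/funext => j; rewrite fe.
  by have [] := fr R (fun j => eval v (ts j)); split.
- by rewrite IH1 IH2.
- have sc a : f \o scons a v = scons (f a) (f \o v).
    by apply/funext => i; rewrite /scons /=; case: unlift.
  split=> H a; first by apply/IH; rewrite sc.
  by rewrite -(gK a) -sc; apply/IH.
Qed.

Fixpoint exq n m : form L (n + m) -> form L m :=
  match n return form L (n + m) -> form L m with
  | 0 => fun phi => phi
  | n'.+1 => fun phi => @exq n' m (FNot (FAll (FNot phi)))
  end.

Lemma fcat_l (X : Type) n m (a : 'I_n -> X) (b : 'I_m -> X) j : fcat a b (lshift m j) = a j.
Proof. by rewrite /fcat -/(unsplit (inl j)) unsplitK. Qed.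

Lemma fcat_r (X : Type) n m (a : 'I_n -> X) (b : 'I_m -> X) j : fcat a b (rshift n j) = b j.
Proof. by rewrite /fcat -/(unsplit (inr j)) unsplitK. Qed.

Lemma fcat0 (X : Type) m (a : 'I_0 -> X) (b : 'I_m -> X) : fcat a b = b.
Proof.
apply/funext => i; rewrite -[RHS](fcat_r a); congr fcat; exact: val_inj.
Qed.

Lemma fcat_scons (X : Type) n m (x : X) (a : 'I_n -> X) (b : 'I_m -> X) :
  fcat (scons x a) b = scons x (fcat a b) :> ('I_(n + m).+1 -> X).
Proof.
apply/funext => i; rewrite -(splitK (i : 'I_(n.+1 + m))).
case: (fintype.split _) => j /=.
- rewrite fcat_l /scons; case: (unliftP ord0 j) => [k|] ->.
    have -> : lshift m (lift ord0 k) = lift ord0 (lshift m k) :> 'I_(n + m).+1 by exact: val_inj.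
    by rewrite liftK fcat_l.
  have -> : lshift m ord0 = ord0 :> 'I_(n + m).+1 by exact: val_inj.
  by rewrite unlift_none.
- rewrite fcat_r /scons.
  have -> : rshift n.+1 j = lift ord0 (rshift n j) :> 'I_(n + m).+1 by exact: val_inj.
  by rewrite liftK fcat_r.
Qed.

Lemma holds_exq (M : structure L) n m (phi : form L (n + m)) (v : 'I_m -> M) :
  holds (exq phi) v <-> exists a : 'I_n -> M, holds phi (fcat a v).
Proof.
elim: n phi => [|n IH] phi /=.
  split=> [H|[a]]; last by rewrite fcat0.
  have a : 'I_0 -> M by case.
  by exists a; rewrite fcat0.
rewrite IH /=; split=> [[a H]|[a H]].
  have [x Hx] : exists x, holds phi (scons x (fcat a v)).
    by apply: contrapT => /forallNP.
  by exists (scons x a); rewrite fcat_scons.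
have aE : a = scons (a ord0) (a \o lift ord0).
  by apply/funext => i; rewrite /scons; case: (unliftP ord0 i) => [j|] ->.
exists (a \o lift ord0) => /(_ (a ord0)); apply.
by rewrite -fcat_scons -aE.
Qed.

End Renaming.

Lemma finite_range (T : Type) (A : set T) :
  finite_set A -> exists n (f : 'I_n -> T), A = range f.
Proof.
move/(@finite_seqP {classic T}) => [s ->]; exists (size s), (tnth (in_tuple s)).
apply/predeqP => x; split=> [/(tnthP (in_tuple s))[i ->]|[i _ <-]]; first by exists i.
exact: (mem_tnth i (in_tuple s)).
Qed.

Lemma range_finite (T : Type) n (f : 'I_n -> T) : finite_set (range f).
Proof. exact/finite_image/finite_finset. Qed.

Lemma split_l n m (j : 'I_n) : fintype.split (lshift m j) = inl j.
Proof. exact: (unsplitK (inl j)). Qed.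

Lemma split_r n m (j : 'I_m) : fintype.split (rshift n j) = inr j.
Proof. exact: (unsplitK (inr j)). Qed.

(** The n variables are shared and the parameter tuples are juxtaposed; [r1] and [r2] redirect the
    indices accordingly. *)
Definition timp L n P (g1 g2 : template L n P) : template L n P :=
  let r1 (i : 'I_(n + tnpar g1)) : 'I_(n + (tnpar g1 + tnpar g2)) :=
    match fintype.split i with inl j => lshift _ j | inr j => rshift n (lshift _ j) end in
  let r2 (i : 'I_(n + tnpar g2)) : 'I_(n + (tnpar g1 + tnpar g2)) :=
    match fintype.split i with inl j => lshift _ j | inr j => rshift n (rshift _ j) end in
  Template (FImp (ren (tbody g1) r1) (ren (tbody g2) r2))
    (fcat (tpar (t:=g1)) (tpar (t:=g2))).

Lemma sat_timp L (M : structure L) n P (e : P -> M) (g1 g2 : template L n P) a :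
  sat a (inst e (timp g1 g2)) <-> (sat a (inst e g1) -> sat a (inst e g2)).
Proof.
case: g1 g2 => [k1 b1 p1] [k2 b2 p2]; rewrite /sat /= !holds_ren.
set r1 := fun i : 'I_(n + k1) => _; set r2 := fun i : 'I_(n + k2) => _.
suff [-> ->] : fcat a (e \o fcat p1 p2) \o r1 = fcat a (e \o p1) /\
  fcat a (e \o fcat p1 p2) \o r2 = fcat a (e \o p2) by [].
split; apply/funext => i; rewrite -(splitK i); case: (fintype.split i) => j /=.
- by rewrite /r1 split_l !fcat_l.
- by rewrite /r1 split_r !fcat_r /= fcat_l.
- by rewrite /r2 split_l !fcat_l.
- by rewrite /r2 split_r !fcat_r /= fcat_r.
Qed.

(** The template [g'] comes before [e], so a single conjunction serves all readings of the names. It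
    is built from implication and falsity. *)
Lemma template_conj L n P r (g : 'I_r -> template L n P) :
  exists g', forall (M : structure L) (e : P -> M) a,
    sat a (inst e g') <-> forall i, sat a (inst e (g i)).
Proof.
have v0 : 'I_0 -> P by case.
pose bot : template L n P := Template FBot v0.
elim: r g => [|r IH] g; first by exists (timp bot bot) => M e a; rewrite sat_timp; split=> // _ [].
have [g' Hg'] := IH (g \o lift ord0).
exists (timp (timp (g ord0) (timp g' bot)) bot) => M e a; rewrite !sat_timp Hg'.
split=> [H i|H0]; last by move=> H; apply: (H (H0 _)) => i; exact: H0.
by apply: contrapT => ni; apply: H => H0 H; case: (unliftP ord0 i) ni => [j|] -> ni; apply: ni;
  [exact: H|exact: H0].
Qed.

(** * Closure properties of definable sets, and realizing consistent sets of formulas *)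

Section Definable.
Variables (L : language) (M : structure L).

Definition definable (E : set M) n (D : set ('I_n -> M)) : Prop :=
  exists psi : pform M n, over E psi /\ forall a, sat a psi <-> D a.

Lemma definable_eq (E : set M) n (D D' : set ('I_n -> M)) :
  (forall a, D a <-> D' a) -> definable E D -> definable E D'.
Proof. by move=> DD' [psi [oE H]]; exists psi; split=> // a; rewrite H. Qed.

(* Each variable of [phi] is either kept or instantiated in [E]; when [E] is
   empty there is no element to pad the parameter tuple with. *)
Lemma definable_form (E : set M) n k (phi : form L k) (g : 'I_k -> 'I_n + M) :
  (forall i c, g i = inr c -> E c) ->
  definable E (fun a => holds phi (fun i => match g i with inl j => a j | inr c => c end)).
Proof.
move=> gE; case: (pselect (exists e, E e)) => [[e0 Ee0]|nE].
  exists (PForm (ren phi (fun i => match g i with inl j => lshift k j | inr _ => rshift n i end))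
    (fun i => match g i with inl _ => e0 | inr c => c end)); split=> [j|a] /=.
    by case Ej: (g j) => [|c] //; apply: gE Ej.
  rewrite /sat /= holds_ren.
  suff -> : fcat a (fun i => match g i with inl _ => e0 | inr c => c end) \o
    (fun i => match g i with inl j => lshift k j | inr _ => rshift n i end) =
    (fun i => match g i with inl j => a j | inr c => c end) by [].
  by apply/funext => i /=; case Ei: (g i) => [j|c]; rewrite ?fcat_l ?fcat_r ?Ei.
have H i : exists j, g i = inl j.
  by case Ei: (g i) => [j|c]; [exists j|exfalso; apply: nE; exists c; exact: gE Ei].
case: (choice H) => r rE.
have v0 : 'I_0 -> M by case.
exists (PForm (ren phi (fun i => lshift 0 (r i))) v0); split=> [[]//|a].
rewrite /sat /= holds_ren.
suff -> : fcat a v0 \o (fun i => lshift 0 (r i)) =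
    (fun i => match g i with inl j => a j | inr c => c end) by [].
by apply/funext => i /=; rewrite fcat_l rE.
Qed.

Lemma definable_imp (E : set M) n (D D' : set ('I_n -> M)) :
  definable E D -> definable E D' -> definable E (fun a => D a -> D' a).
Proof.
move=> [[k1 b1 p1] [o1 H1]] [[k2 b2 p2] [o2 H2]].
exists (inst id (timp (Template b1 p1) (Template b2 p2))); split=> [j /=|a].
  by rewrite /fcat; case: fintype.split => i; [exact: o1|exact: o2].
by rewrite sat_timp -H1 -H2.
Qed.

Lemma definable_false (E : set M) n : definable E (fun _ : 'I_n -> M => False).
Proof.
have v0 : 'I_0 -> M by case.
by exists (PForm FBot v0); split=> // -[].
Qed.

Lemma definable_not (E : set M) n (D : set ('I_n -> M)) :
  definable E D -> definable E (fun a => ~ D a).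
Proof. by move=> H; apply: definable_imp H _; exact: definable_false. Qed.

Lemma definable_and (E : set M) n (D D' : set ('I_n -> M)) :
  definable E D -> definable E D' -> definable E (fun a => D a /\ D' a).
Proof.
move=> H H'; apply: definable_eq (definable_not (definable_imp H (definable_not H'))).
by move=> a; split=> [/not_implyP[? /contrapT]|[? ?]]; [|apply].
Qed.

Lemma definable_all (E : set M) n k (D : 'I_k -> set ('I_n -> M)) :
  (forall j, definable E (D j)) -> definable E (fun a => forall j, D j a).
Proof.
elim: k D => [|k IH] D DE.
  by apply: definable_eq (definable_not (definable_false E n)) => a; split=> // _ [].
apply: definable_eq (definable_and (DE ord0) (IH (D \o lift ord0) (fun j => DE _))) => a.
split=> [[H0 H] j|H]; last by split=> [|j]; exact: H.
by case: (unliftP ord0 j) => [i|] ->; [exact: H|exact: H0].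
Qed.

Lemma definable_ex (E : set M) n m (D : set ('I_(n + m) -> M)) :
  definable E D -> definable E (fun y : 'I_m -> M => exists x : 'I_n -> M, D (fcat x y)).
Proof.
move=> [[k b p] [o H]].
exists (PForm (exq (ren b (cast_ord (esym (addnA n m k))))) p); split=> // y.
have E1 x : fcat x (fcat y p) \o cast_ord (esym (addnA n m k)) = fcat (fcat x y) p.
  apply/funext => i /=; rewrite -(splitK i); case: (fintype.split i) => j /=.
    rewrite fcat_l -(splitK j); case: (fintype.split j) => l /=; rewrite ?fcat_l ?fcat_r.
      by rewrite -(fcat_l x (fcat y p) l); congr fcat; exact: val_inj.
    rewrite -(fcat_l y p l) -(fcat_r x (fcat y p) (lshift k l)); congr fcat; exact: val_inj.
  rewrite fcat_r -(fcat_r y p j) -(fcat_r x (fcat y p) (rshift m j)); congr fcat.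
  by apply: val_inj; rewrite /= addnA.
rewrite /sat holds_exq /=; split=> -[x Hx]; exists x; move: Hx; rewrite -H /sat holds_ren E1 //.
Qed.

Lemma definable_par (E : set M) n (phi : pform M n) :
  over E phi -> definable E (fun a => sat a phi).
Proof. by move=> o; exists phi. Qed.

Lemma definable_sub (E : set M) n m (D : set ('I_n -> M)) (r : 'I_n -> 'I_m) :
  definable E D -> definable E (fun a => D (a \o r)).
Proof.
move=> [[k b p] [o H]].
pose g (i : 'I_(n + k)) : 'I_m + M :=
  match fintype.split i with inl j => inl (r j) | inr j => inr (p j) end.
have /definable_eq : forall a, holds b (fun i => match g i with inl j => a j | inr c => c end) <-> D (a \o r).
  move=> a; rewrite -H /sat /=.
  suff -> : (fun i => match g i with inl j => a j | inr c => c end) = fcat (a \o r) p by [].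
  by apply/funext => i; rewrite /g /fcat; case: fintype.split.
apply; apply: definable_form => i c.
by rewrite /g; case: fintype.split => // j [<-]; exact: o.
Qed.

Lemma definable_const (E : set M) n (j : 'I_n) (c : M) : E c ->
  definable E (fun a => a j = c).
Proof.
move=> Ec.
pose g (i : 'I_2) : 'I_n + M := if val i is 0 then inl j else inr c.
apply: definable_eq (@definable_form E n 2 (FEq (TVar L ord0) (TVar L ord_max)) g _) => //.
by move=> [[|[|]]]// _ d [<-].
Qed.

Lemma definable_var (E : set M) n (i j : 'I_n) : definable E (fun a => a i = a j).
Proof.
pose g (k : 'I_2) : 'I_n + M := if val k is 0 then inl i else inl j.
apply: definable_eq (@definable_form E n 2 (FEq (TVar L ord0) (TVar L ord_max)) g _) => //.
by move=> [[|[|]]].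
Qed.

Lemma definable_sub_set (E E' : set M) n (D : set ('I_n -> M)) :
  E `<=` E' -> definable E D -> definable E' D.
Proof. by move=> EE' [psi [o H]]; exists psi; split=> // j; exact: EE'. Qed.

Lemma tp_definable (A : set M) n (b c : 'I_n -> M) D :
  tp b A = tp c A -> definable A D -> D b <-> D c.
Proof.
move=> E [psi [o H]]; rewrite -!H.
have Ed : tp b A psi <-> tp c A psi by rewrite E.
by split=> s; [case: (Ed.1 (conj o s))|case: (Ed.2 (conj o s))].
Qed.

Section Saturated.
Variable K : Type.
Hypothesis Msat : saturated K M.

(* The formulas over [A] true along an ultrafilter refining [p] form a complete
   type. *)
Lemma consistent_realized n (A : set M) (p : ptype M n) :
  small K A -> (forall phi, p phi -> over A phi) -> consistent p ->
  exists a, realizes a p.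
Proof.
move=> sA pA pc.
pose F : set_system ('I_n -> M) := fun S =>
  exists X : ptype M n, [/\ finite_set X, X `<=` p & forall a, realizes a X -> S a].
have FF : ProperFilter F.
  apply: Build_ProperFilter_ex => [S [X [fX Xp XS]]|].
    by have [a /XS] := pc X fX Xp; exists a.
  split=> [|S S' [X [fX Xp XS]] [Y [fY Yp YS]]|S S' SS' [X [fX Xp XS]]].
  - by exists set0; split.
  - exists (X `|` Y); split; first by rewrite finite_setU.
      by move=> phi [/Xp|/Yp].
    by move=> a H; split; [apply: XS|apply: YS] => phi ?; apply: H; [left|right].
  - by exists X; split=> // a /XS/SS'.
have [U [UU FU]] := ultraFilterLemma FF.
pose q : ptype M n := [set phi | over A phi /\ U [set a | sat a phi]].
have pq : p `<=` q.
  move=> phi pphi; split; first exact: pA.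
  apply: FU; exists [set phi]; split=> [||a]; [exact: finite_set1|by move=> _ ->|exact].
have [|a Ha] := Msat sA (_ : types_over A q); last by exists a => phi /pq; exact: Ha.
split=> [phi []//|X fX Xq|phi o].
  have [m [f XE]] := finite_range fX.
  have /filter_ex[a Ha] : U [set a | forall j, sat a (f j)].
    apply: filter_forall => j; have [] := Xq (f j) => //.
    by rewrite XE; exists j.
  by exists a => phi; rewrite XE => -[j _ <-].
case: (in_ultra_setVsetC [set a | sat a phi] UU) => H; [left|right]; split=> //.
Qed.

End Saturated.
End Definable.

(** * Long dividing families *)

(** The finite character that lets k-inconsistency pass to unions of chains in Zorn's lemma. *)
Lemma chain_finite (T : Type) (F : set (set T)) k (s : 'I_k -> T) :
  total_on F subset -> F !=set0 -> (forall j, (\bigcup_(X in F) X) (s j)) ->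
  exists2 X, F X & forall j, X (s j).
Proof.
move=> Ftot [X0 FX0]; elim: k s => [|k IH] s Hs; first by exists X0 => // -[].
have [X FX HX] := IH (s \o lift ord0) (fun j => Hs _).
have [Y FY HY] := Hs ord0.
have [XY|YX] := Ftot X Y FX FY.
- by exists Y => // j; case: (unliftP ord0 j) => [i|] ->; [exact/XY/HX|].
- by exists X => // j; case: (unliftP ord0 j) => [i|] ->; [exact: HX|exact: YX].
Qed.

Lemma infinite_inj (T : Type) (A : set T) : infinite_set A ->
  exists h : nat -> T, injective h /\ forall i, A (h i).
Proof.
move=> /infiniteP/card_le_emb/(emb_trans (emb_setT nat))[h hI].
exists (val \o h); split=> [|i]; first exact: inj_comp val_inj hI.
exact: set_mem (valP (h i)).
Qed.

Lemma infinite_fiber (T : Type) (f : nat -> T) : finite_set (range f) ->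
  exists c, infinite_set [set i | f i = c].
Proof.
move=> fin; apply: contrapT => /forallNP H; apply: infinite_nat.
apply: (@sub_finite_set _ _ (\bigcup_(c in range f) [set i | f i = c])).
  by move=> i _; exists (f i) => //; exists i.
by apply: bigcup_finite => // c _; apply: contrapT; exact: H.
Qed.

Lemma finite_subset (T : Type) (A B : set T) : finite_set B -> A `<=` B -> finite_set A.
Proof. by move=> fB AB; exact: sub_finite_set AB fB. Qed.

(** * Conjugation by automorphisms and enlarging a dividing sequence *)

Section Forward.
Variables (L : language) (M : structure L).

Lemma sat_pmap (f : M -> M) n (a : 'I_n -> M) (phi : pform M n) :
  automorphism f -> sat (f \o a) (pmap f phi) <-> sat a phi.
Proof.
move=> fA; have := holds_auto (body phi) (fcat a (par (p:=phi))) fA.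
suff -> : f \o fcat a (par (p:=phi)) = fcat (f \o a) (f \o par (p:=phi)) by [].
by apply/funext => i; rewrite /fcat /=; case: fintype.split.
Qed.

Lemma realizes_conj (f : M -> M) n (a : 'I_n -> M) (p : ptype M n) :
  automorphism f -> realizes (f \o a) (conj_type f p) <-> realizes a p.
Proof.
move=> fA; split=> [H phi pphi|H _ [phi pphi <-]]; last by apply/sat_pmap => //; exact: H.
by apply/(sat_pmap _ _ fA)/H; exists phi.
Qed.

Lemma realizes_conj' (f : M -> M) n (a : 'I_n -> M) (p : ptype M n) :
  automorphism f -> realizes a (conj_type f p) -> exists2 c, a = f \o c & realizes c p.
Proof.
move=> fA; case: (fA) => -[g fK gK] _ _ H.
have aE : a = f \o (g \o a) by apply/funext => i /=; rewrite gK.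
by exists (g \o a) => //; apply/(realizes_conj _ _ fA); rewrite -aE.
Qed.

Lemma dom_conj (f : M -> M) n (p : ptype M n) B :
  (forall phi, p phi -> over B phi) -> dom (conj_type f p) `<=` f @` B.
Proof.
by move=> pB a [_ [[phi pphi <-] [j <-]]]; exists (par (p:=phi) j) => //; exact: pB.
Qed.

Lemma conj_fix (f : M -> M) n A (p q : ptype M n) :
  (forall phi, p phi -> over A phi) -> (forall a, A a -> f a = a) -> p `<=` q ->
  p `<=` conj_type f q.
Proof.
move=> pA fA pq phi pphi; exists phi; first exact: pq.
case: phi pphi => m b c pphi; congr PForm; apply/funext => j /=.
by rewrite fA //; exact: (pA _ pphi).
Qed.

Variable K : Type.
Hypotheses (Kunc : ~ countable [set: K]) (Klim : strong_limit K).
Hypotheses (Msat : saturated K M) (Mhom : strongly_homogeneous K M).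

(** Equality of types makes the map fixing [A] and sending [b] to [c] well defined and elementary,
    since equalities among entries of [b] and elements of [A] are formulas over [A]; homogeneity
    then extends it. *)
Lemma tp_conj (A : set M) m (b c : 'I_m -> M) : small K A -> tp b A = tp c A ->
  exists f, [/\ automorphism f, forall a, A a -> f a = a & f \o b = c].
Proof.
move=> sA E.
pose f (x : M) := if pselect (exists j, b j = x) is left H then c (sval (cid H)) else x.
have fb j : f (b j) = c j.
  rewrite /f; case: pselect => [H|[]]; last by exists j.
  apply/(tp_definable E (definable_var A (sval (cid H)) j)).
  exact: svalP (cid H).
have fA a : A a -> f a = a.
  move=> Aa; rewrite /f; case: pselect => // H.
  apply/(tp_definable E (definable_const (sval (cid H)) Aa)).
  exact: svalP (cid H).
have sAb : small K (A `|` range b).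
  apply: (small_setU Klim) => //.
  by apply: (small_cover (f := b) (@smallT_ord _ Kunc m)); exact: subset_refl.
have [n phi a Aa|g [gA gE]] := Mhom sAb (f := f).
  (* Each entry of [a] becomes a position in [b] or a parameter in [A], so the formula turns into a
     condition on [b] definable over [A]. *)
  pose g i : 'I_m + M := if pselect (exists j, b j = a i) is left H then inl (sval (cid H)) else inr (a i).
  have gE i x : g i = inr x -> A x.
    rewrite /g; case: pselect => // nb [<-].
    by case: (Aa i) => // -[j _ bj]; exfalso; apply: nb; exists j.
  have := tp_definable E (definable_form phi gE).
  have -> : (fun i => match g i with inl j => b j | inr x => x end) = a.
    by apply/funext => i; rewrite /g; case: pselect => // H; exact: svalP (cid H).
  suff -> : (fun i => match g i with inl j => c j | inr x => x end) = f \o a by [].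
  by apply/funext => i; rewrite /g /f /=; case: pselect.
exists g; split=> // [a Aa|].
  by rewrite gE ?fA //; left.
by apply/funext => j /=; rewrite gE ?fb //; right; exists j.
Qed.

Lemma long_dividing n (phi : pform M n) (A : set M) : small K A ->
  formula_divides phi A -> (exists a, sat a phi) ->
  exists (k : nat) (S : set ('I_(npar phi) -> M)),
    [/\ (2 <= k)%N, ~ small K S,
        forall s, S s -> tp (par (p:=phi)) A = tp s A &
        forall s : 'I_k -> 'I_(npar phi) -> M, injective s -> (forall j, S (s j)) ->
          ~ exists a, forall j, sat a (PForm (body phi) (s j))].
Proof.
case: phi => m bd b sA [k [bs [/= bsA kinc]]] [a0 sat0].
(* Raising k to [k.+2] keeps the inconsistency and secures the bound 2 <= k that weak bounded
   multiplicity asks for. *)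
pose good (S : set ('I_m -> M)) := (forall s, S s -> tp b A = tp s A) /\
   forall s : 'I_k.+2 -> 'I_m -> M, injective s -> (forall j, S (s j)) ->
          ~ exists a, forall j, sat a (PForm bd (s j)).
have incn (s : 'I_k.+2 -> nat) : injective s -> ~ exists a, forall j, sat a (PForm bd (bs (s j))).
  move=> sI [a Ha]; have kk : (k <= k.+2)%N by rewrite -addn2 leq_addr.
  apply: (kinc (s \o widen_ord kk)) => // [x y /sI/(congr1 val)/= E|F _ FS].
    exact: val_inj.
  by exists a => phi /FS[j _ ->]; exact: Ha.
have exb c : tp b A = tp c A -> exists x, holds bd (fcat x c).
  move=> E.
  have dbd := @definable_form _ M A (n + m) (n + m) bd inl ltac:(by []).
  by apply/(tp_definable E (definable_ex dbd)); exists a0.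
pose S0 := range bs.
(* By [exb] every conjugate of [b] gives a satisfiable instance, so a tuple repeated infinitely
   often would contradict [incn]. *)
have S0inf : infinite_set S0.
  move=> /infinite_fiber[c /infinite_inj[h [hI hc]]].
  have [|a Ha] := exb c; first by rewrite -(hc 0).
  apply: (incn (h \o val)); first exact: inj_comp hI val_inj.
  by exists a => j; rewrite /sat /= hc.
have S0good : good S0.
  split=> [s [i _ <-]|s sI Hs] //.
  have /choice[t tE] : forall j, exists i, bs i = s j.
    by move=> j; have [i _ <-] := Hs j; exists i.
  have -> : s = bs \o t by apply/funext => j; rewrite /= tE.
  by apply: incn => x y /(congr1 bs); rewrite !tE => /sI.
have [F FP Ftot|S1 [S1good S1max]] := @Zorn_bigcup _ (fun S => good (S `|` S0)).
  (* Adding [S0] itself keeps the chain nonempty even when [F] is empty. *)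
  pose F' : set (set ('I_m -> M)) := fun X => X = S0 \/ exists2 Y, F Y & X = Y `|` S0.
  have F'good X : F' X -> good X by move=> [->|[Y /FP HY ->]].
  have F'tot : total_on F' subset.
    move=> X Y [->|[X' FX ->]] [->|[Y' FY ->]].
    - by left.
    - by left; exact: subsetUr.
    - by right; exact: subsetUr.
    - by case: (Ftot _ _ FX FY) => H; [left|right]; exact: setSU.
  have F'cup s : (\bigcup_(X in F) X `|` S0) s -> (\bigcup_(X in F') X) s.
    move=> [[X FX Xs]|S0s]; last by exists S0 => //; left.
    by exists (X `|` S0); [right; exists X|left].
  split=> [s /F'cup[X /F'good[H _]]|s sI Hs]; first exact: H.
  have [||X /F'good[_ H] HX] := chain_finite F'tot (s := s).
  - by exists S0; left.
  - by move=> j; apply: F'cup.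
  - exact: H.
pose S := S1 `|` S0.
exists k.+2, S; split=> //; [|exact: S1good.1|exact: S1good.2].
move=> sS.
pose E := A `|` \bigcup_(s in S) range s.
have AE : A `<=` E by exact: subsetUl.
have SE s j : S s -> E (s j) by move=> Ss; right; exists s => //; exists j.
have sE : small K E.
  apply: small_setU => //.
  apply: (small_bigcup Klim (g := id) sS (@smallT_ord _ Kunc m)) => s Ss; exact: subset_refl.
(* Finitely many formulas of [pi] fail at only finitely many members of the infinite set [S0], so
   [pi] is consistent; its realization [c] will be a new member for [S1]. *)
pose pi : ptype M m := [set psi | over E psi /\ finite_set [set s | S0 s /\ ~ sat s psi]].
have [|F Ffin Fpi|c Hc] := consistent_realized Msat sE (p := pi); first by move=> psi [].
  have [r [f FE]] := finite_range Ffin.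
  apply: contrapT => /forallNP H; apply: S0inf.
  apply: (@sub_finite_set _ _ (\bigcup_(i in [set: 'I_r]) [set s | S0 s /\ ~ sat s (f i)])).
    move=> s S0s; apply: contrapT => nF; apply: (H s) => psi; rewrite FE => -[i _ <-].
    by apply: contrapT => ns; apply: nF; exists i.
  apply: bigcup_finite => [|i _]; first exact: finite_finset.
  by have [] := Fpi (f i) => //; rewrite FE; exists i.
have cD D : definable E D -> finite_set [set s | S0 s /\ ~ D s] -> D c.
  move=> [psi [o H]] fin; apply/H/Hc; split=> //.
  by apply: sub_finite_set fin => s [S0s ns]; split=> // Ds; apply: ns; apply/H.
have tpc : tp b A = tp c A.
  have dE (phi : pform M m) : over A phi -> definable E (fun y => sat y phi).
    by move=> o; apply: definable_sub_set AE _; exact: definable_par.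
  have bS phi s : over A phi -> S0 s -> sat b phi <-> sat s phi.
    by move=> o S0s; exact: (tp_definable (S0good.1 _ S0s) (definable_par o)).
  apply/predeqP => phi; split=> -[o H]; split=> //.
    apply: (cD (fun y => sat y phi) (dE _ o)); apply: (finite_subset (@finite_set0 _)) => s [S0s]; apply.
    exact/(bS _ _ o S0s).
  apply: contrapT => nb; move: H.
  apply: (cD (fun y => ~ sat y phi)); first exact/definable_not/dE.
  apply: (finite_subset (@finite_set0 _)) => s [S0s]; apply=> ss; apply: nb.
  exact/(bS _ _ o S0s).
(* If [c] were in [S], being different from [c] would be definable over [E] and fail at one tuple at
   most, hence would hold of [c]. *)
have nSc : ~ S c.
  move=> Sc; suff : ~ (forall j, c j = c j) by apply.
  apply: (cD (fun y => ~ (forall j, y j = c j))).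
    by apply/definable_not/definable_all => j; apply: definable_const; exact: SE.
  apply: (finite_subset (finite_set1 c)) => s [_ /contrapT H].
  by apply/funext.
apply: (S1max (S1 `|` [set c])).
  split=> [|sub]; first exact: subsetUl.
  by apply: nSc; left; apply: sub; right.
rewrite setUAC -/S; split=> [s [/S1good.1//|-> //]|s sI Hs].
case: (pselect (exists j0, s j0 = c)) => [[j0 Ej0]|nc]; last first.
  apply: S1good.2 => // j; case: (Hs j) => // jc.
  by exfalso; apply: nc; exists j.
have Hl j : S (s (lift j0 j)).
  case: (Hs (lift j0 j)) => //= E1; exfalso.
  by have /sI/eqP := etrans E1 (esym Ej0); rewrite eq_sym (negPf (neq_lift _ _)).
(* With the other entries of [s] fixed, a common solution is a definable condition on the entry at
   [j0]; it is enough to refute it for all but finitely many members of [S0]. *)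
suff H : ~ exists x, holds bd (fcat x c) /\ forall j, sat x (PForm bd (s (lift j0 j))).
  move=> [x Hx]; apply: H; exists x; split=> [|j]; last exact: Hx.
  by have := Hx j0; rewrite Ej0.
apply: (cD (fun y => ~ exists x, holds bd (fcat x y) /\ forall j, sat x (PForm bd (s (lift j0 j))))).
  apply: definable_not.
  have dbd := @definable_form _ M E (n + m) (n + m) bd inl ltac:(by []).
  have dpar j : definable E (fun z : 'I_(n + m) -> M => sat (z \o @lshift n m) (PForm bd (s (lift j0 j)))).
    have o : over E (PForm bd (s (lift j0 j))) by move=> i /=; exact: SE.
    exact: (definable_sub (@lshift n m) (definable_par o)).
  apply: definable_eq (definable_ex (definable_and dbd (definable_all dpar))) => y.
  have El x : fcat x y \o @lshift n m = x by apply/funext => i; rewrite /= fcat_l.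
  by split=> -[x [H1 H2]]; exists x; split=> // j; have := H2 j; rewrite El.
(* The possible exceptions are members of [S0] already among the other entries; any other [s']
   completes these to distinct members of [S]. *)
apply: (finite_subset (range_finite (s \o lift j0))) => s' [S0s' /contrapT[x [H1 H2]]].
apply: contrapT => ns'.
pose t j := if j == j0 then s' else s j.
have tl j : t (lift j0 j) = s (lift j0 j) by rewrite /t eq_sym (negPf (neq_lift _ _)).
have t0 : t j0 = s' by rewrite /t eqxx.
apply: (S1good.2 t).
- move=> i j; case: (unliftP j0 i) => [i'|] ->; case: (unliftP j0 j) => [j'|] ->; rewrite ?tl ?t0 //.
  + by move/sI.
  + by move=> E1; exfalso; apply: ns'; exists i'.
  + by move=> E1; exfalso; apply: ns'; exists j'.
- move=> j; case: (unliftP j0 j) => [j'|] ->; rewrite ?tl ?t0 //; first exact: Hl.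
  by right.
- by exists x => j; case: (unliftP j0 j) => [j'|] ->; rewrite ?tl ?t0 //; exact: H2.
Qed.

End Forward.

(** * Dividing ranks and multiplicity *)

Lemma emb_range (U V : Type) (f : U -> V) : injective f -> emb U (range f).
Proof.
move=> fI; have fR u : f u \in range f by rewrite inE; exists u.
exists (fun u => exist (fun v => v \in range f) (f u) (fR u)) => u v /(congr1 val).
exact: fI.
Qed.

Lemma emb_fibers (U V W : Type) (F : U -> V) :
  (forall v, emb [set u | F u = v] W) -> emb U (V * W).
Proof.
move=> H; pose h v := sval (cid (H v)).
have hI v : injective (h v) by exact: svalP (cid (H v)).
have FE u : u \in [set w | F w = F u] by rewrite inE.
pose w u := exist (fun x => x \in [set w | F w = F u]) u (FE u).
exists (fun u => (F u, h (F u) (w u))) => u v [E].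
have E' : forall y (e : F v = y) (vy : v \in [set x | F x = y]),
    h (F v) (w v) = h y (exist (fun x => x \in _) v vy).
  by move=> y e; subst y => vy; congr (h _ _); exact: val_inj.
have vu : v \in [set x | F x = F u] by rewrite inE E.
by rewrite (E' _ (esym E) vu) => /hI/(congr1 val).
Qed.

Section Multiplicity.
Variables (K : Type) (L : language) (M : structure L).
Variables (d : Order.disp_t) (O : tOrderType d).
Variables (AA : forall n : nat, set (ptype M n)) (R : forall n : nat, ptype M n -> O).
Arguments R {n}.
Hypotheses (Kunc : ~ countable [set: K]) (Klim : strong_limit K).
Hypotheses (AAcl : type_class K AA) (Rk : is_rank AA (@R)).

(** * From bounded multiplicity to dividing *)

Lemma weak_bounded_multiplicity_dividing :
  saturated K M -> strongly_homogeneous K M ->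
  weak_bounded_multiplicity K AA (@R) -> dividing_rank K AA (@R).
Proof.
move=> Msat Mhom wbm n A B p q sA sB tA tB Ap Aq pq rp [phi [qphi fd]].
have [AA1 _ AA3] := AAcl; have [R1 R2] := Rk.
have := R1 _ _ _ Ap Aq pq; rewrite le_eqVlt => /orP[/eqP Rqp|//]; exfalso.
have [a0 a0q] := Msat _ _ _ sB tB.
have [k [S [k2 nS tpS Sinc]]] := long_dividing Kunc Klim Msat sA fd (ex_intro _ a0 (qphi _ a0q)).
have /choice[f fP] : forall s, exists f, S s ->
    [/\ automorphism f, forall a, A a -> f a = a & f \o par (p:=phi) = s].
  move=> s; case: (pselect (S s)) => [Ss|nSs]; last by exists id.
  by have [f Hf] := tp_conj Kunc Klim Mhom sA (tpS _ Ss); exists f.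
have satS s a : S s -> realizes a (conj_type (f s) q) -> sat a (PForm (body phi) s).
  move=> Ss; have [fA _ fE] := fP _ Ss.
  case/(realizes_conj' fA) => c -> /qphi /(sat_pmap _ _ fA).
  by rewrite /pmap fE.
have qB phi' : q phi' -> over B phi' by case: tB => H _ _; exact: H.
have pA phi' : p phi' -> over A phi' by case: tA => H _ _; exact: H.
(* The set [range g] is a copy of [B] inside [K] and bounds the domains of all conjugates of [q]. *)
have [g gI] := smallT_into ((smallP K B).1 sB).
have slam : small K (range g).
  by apply: (small_cover (f := g)); [exact/smallP|exact: subset_refl].
have [kappa [skappa Hkappa]] := wbm n p Ap rp k k2 _ slam.
pose C : set (ptype M n) := [set conj_type (f s) q | s in S].
have CS r : C r -> exists2 s, S s & r = conj_type (f s) q by case=> s Ss <-; exists s.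
have CA s : S s -> complete_type K (conj_type (f s) q).
  by move=> Ss; apply/AA1/AA3 => //; have [] := fP _ Ss.
have Ckappa : C #<= kappa.
  apply: Hkappa => [s sI Cs cons|_ [s Ss <-]]; last first.
    have [fA fid _] := fP _ Ss; split.
    - exact: CA.
    - exact: conj_fix pA fid pq.
    - apply: (card_le_trans (subset_card_le (dom_conj (f := f s) qB))).
      by apply: (card_le_trans (card_image_le _ _)); apply/card_le_emb/emb_range.
    - by rewrite -(R2 _ _ _ Aq fA).
  have /choice[t tP] : forall j, exists x, S x /\ s j = conj_type (f x) q.
    by move=> j; have [x Sx E] := CS _ (Cs j); exists x.
  (* Saturation over the union of the conjugated domains yields one realization, which satisfies the
     instances at k distinct members of [S]. *)
  have [||a Ha] := consistent_realized Msat _ _ cons (A := \bigcup_(j in [set: 'I_k]) (f (t j) @` B)).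
  - apply: (small_bigcup Klim (V := B) (g := fun j b => f (t j) (val b))).
    + by apply/smallT_small; exact: smallT_ord.
    + exact/smallP.
    + by move=> j _ _ [b Bb <-]; exists (exist _ b (mem_set Bb)).
  - move=> psi [j _]; have [_ ->] := tP j; case=> chi qchi <- i.
    by exists j => //; exists (par (p:=chi) i) => //; exact: qB.
  - apply: (Sinc t) => [x y E|j|].
    + by apply: sI; have [_ ->] := tP x; have [_ ->] := tP y; rewrite E.
    + by have [] := tP j.
    + exists a => j; have [St sE] := tP j; apply: satS => // psi cpsi.
      by apply: Ha; exists j => //; rewrite sE.
have fC (s : S) : conj_type (f (val s)) q \in C.
  by rewrite inE; exists (val s) => //; exact: set_mem (valP s).
pose F (s : S) : C := exist (fun r => r \in C) _ (fC s).
(* Different [s] may give the same type, but only finitely many do: a realization of that type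
   satisfies all their instances. So [S] would embed into the small type [C * nat]. *)
have [] : ~ emb S (C * nat).
  move=> SC; have : smallT K (C * nat).
    apply: smallT_prod => //; last exact: smallT_nat.
    by apply: smallT_emb ((smallP K kappa).1 skappa); apply/card_le_emb.
  by move/(smallT_emb SC)/smallP.
apply: (emb_fibers (F := F)) => v.
apply: emb_trans (emb_sub setT); apply/card_le_emb/finite_set_countable.
apply: contrapT => /infinite_inj[h [hI hv]].
have hS i : S (val (h i)) by exact: set_mem (valP (h i)).
have hE i : val v = conj_type (f (val (h i))) q by rewrite -(hv i).
have [B' [sB' tB']] : complete_type K (val v) by rewrite (hE 0); exact: CA.
have [a Ha] := Msat _ _ _ sB' tB'.
apply: (Sinc (fun j => val (h (val j)))) => [x y /val_inj/hI/val_inj //|j|]; first exact: hS.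
by exists a => j; apply: satS; [exact: hS|rewrite -hE].
Qed.

(** * From dividing to bounded multiplicity *)

Lemma cover_of_card_le (X : set M) (lambda : set K) : X #<= lambda ->
  exists e : lambda -> M, X `<=` range e.
Proof.
move/card_le_emb => [g gI]; have [x0] := carrier_inhabited M.
exists (fun l => if pselect (exists x, g x = l) is left H then val (sval (cid H)) else x0).
move=> x Xx; exists (g (exist _ x (mem_set Xx))) => //.
case: pselect => [H|[]]; last by eexists.
by have /gI -> := svalP (cid H).
Qed.

Lemma dividing_weak_bounded_multiplicity :
  small K [set: fsym L] -> small K [set: rsym L] ->
  dividing_rank K AA (@R) -> weak_bounded_multiplicity K AA (@R).
Proof.
move=> /smallT_small sf /smallT_small sr div n p Ap rp k k2 lambda /smallP slam.
have [AA1 AA2 _] := AAcl.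
have [A [sA tA]] := AA1 _ _ Ap.
have [W sW ER] := erdos_rado Kunc Klim k (@smallT_template K Kunc Klim L n lambda sf sr slam).
(* Invariants of a member: the type itself, read through an enumeration of its domain by [lambda],
   and the type of that enumeration over [A]. *)
pose J : Type := (set (template L n lambda) * set (template L 0 (A + lambda)))%type.
have sJ : smallT K J.
  apply: smallT_prod => //; apply: smallT_set => //; apply: smallT_template => //.
  by apply: smallT_sum => //; exact/smallP.
(* The bound is the size of [J * W], fixed before [C]: if it fails, some fibre of [inv] is too large
   to embed in [W]. *)
have [g gI] := smallT_into (smallT_prod Klim sJ sW).
exists (range g); split.
  by apply: (small_cover (smallT_prod Klim sJ sW)); exact: subset_refl.
move=> C Cinc CP; apply/card_le_emb; apply: emb_trans (emb_range gI).
have CP' (c : C) := CP _ (set_mem (valP c)).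
have He (c : C) : exists e : lambda -> M, dom (val c) `<=` range e.
  by apply: cover_of_card_le; have [] := CP' c.
pose e c := sval (cid (He c)).
have eP c : dom (val c) `<=` range (e c) by exact: svalP (cid (He c)).
pose eA (c : C) (x : A + lambda) := match x with inl a => val a | inr l => e c l end.
have v0 : 'I_0 -> M by case.
pose inv (c : C) : J := ([set t | val c (inst (e c) t)], [set t | sat v0 (inst (eA c) t)]).
apply: (emb_fibers (F := inv)) => v; apply: contrapT => /ER{}ER.
set X := [set u | inv u = v] in ER.
pose q (c : X) : ptype M n := val (val c).
pose ex (c : X) := e (val c).
have templ (c : X) phi : q c phi -> exists t, phi = inst (ex c) t.
  case: phi => m b a qphi.
  have /choice[t tE] : forall j, exists l, ex c l = a j.
    move=> j; have [|l _ lE] := eP (val c) (a j); last by exists l.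
    by exists (PForm b a); split=> //; exists j.
  by exists (Template b t); rewrite /inst /=; congr PForm; apply/funext => j; rewrite /= tE.
have invE (c c' : X) : inv (val c) = inv (val c').
  have H (b : X) : inv (val b) = v by exact: set_mem (valP b).
  by rewrite !H.
have q_inst (c c' : X) t : q c (inst (ex c) t) -> q c' (inst (ex c') t).
  by move=> H; have [/predeqP/(_ t)[/(_ H)]] := invE c c'.
have tpE (c c' : X) m (t : 'I_m -> lambda) : tp (ex c \o t) A = tp (ex c' \o t) A.
  have sub c1 c2 : tp (ex c1 \o t) A `<=` tp (ex c2 \o t) A.
    move=> [r b a] [o s]; split=> //.
    (* A formula over [A] about the enumerated tuple becomes a template without variables, with
       names from both [A] and [lambda]. *)
    pose dl : template L 0 (A + lambda) := @Template L 0 _ (m + r) b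
      (fcat (inr \o t) (fun j => inl (exist _ (a j) (mem_set (o j))))).
    have dlE (c3 : X) : eA (val c3) \o tpar (t:=dl) = fcat (ex c3 \o t) a.
      by apply/funext => j; rewrite /dl /= /fcat; case: fintype.split.
    have [_ /predeqP/(_ dl)[+ _]] := invE c1 c2.
    by rewrite /= /sat /= !dlE !fcat0; apply.
  by apply/seteqP; split; exact: sub.
pose good (S : set X) t := (forall c, S c -> forall a, realizes a (q c) -> sat a (inst (ex c) t)) /\
   ~ exists a, forall c, S c -> sat a (inst (ex c) t).
have tbot : template L n lambda.
  by apply: (@Template _ _ _ 0 FBot); case.
(* The colour of a set is a template witnessing its inconsistency; [tbot] is a default for sets
   without a witness. *)
pose col (S : set X) := if pselect (exists t, good S t) is left H then sval (cid H) else tbot.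
have colP (s : 'I_k -> X) : injective s -> good (range s) (col (range s)).
  move=> sI; suff H : exists t, good (range s) t.
    by rewrite /col; case: pselect => // H'; exact: svalP (cid H').
  have nc : ~ consistent (\bigcup_j q (s j)).
    apply: (Cinc (fun j => q (s j))) => [x y /val_inj/val_inj/sI //|j].
    exact: set_mem (valP (val (s j))).
  have [F [Ffin FU nF]] : exists F, [/\ finite_set F, F `<=` \bigcup_j q (s j) & ~ exists a, realizes a F].
    apply: contrapT => H; apply: nc => F Ffin FU; apply: contrapT => nF.
    by apply: H; exists F.
  have [r [f FE]] := finite_range Ffin.
  have /choice[c cP] : forall i, exists j, q (s j) (f i).
    by move=> i; have [|j _ H] := FU (f i); [rewrite FE; exists i|exists j].
  have /choice[t tP] := fun i => templ _ _ (cP i).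
  (* The formulas of [F] come from different members, but members of one fibre contain the same
     templates, so each contains its own instance of every conjunct of [t']. *)
  have [t' t'P] := template_conj t.
  exists t'; split=> [_ [j _ <-] a aq|[a Ha]].
    apply/t'P => i; apply: aq; apply: (q_inst (s (c i))); rewrite -tP; exact: cP.
  apply: nF; exists a => phi; rewrite FE => -[i _ <-]; rewrite tP.
  by have /t'P := Ha (s (c i)) (imageT _ _); apply.
have [h [t [hI hcol]]] := ER col.
have hgood (s : 'I_k -> nat) : injective s -> good (range (h \o s)) t.
  by move=> sI; rewrite -(hcol s sI); apply: colP; exact: inj_comp hI sI.
have [cq pq _ Rq] := CP' (val (h 0)).
have [B [sB tB]] := cq.
have Aq := AA2 _ _ _ Ap cq pq.
suff dq : divides (q (h 0)) A.
  by have := div _ _ _ _ _ sA sB tA tB Ap Aq pq rp dq; rewrite Rq ltxx.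
exists (inst (ex (h 0)) t); split.
  have [H _] := hgood val val_inj; apply: H.
  (* Since k is positive, [h 0] belongs to the k-subset given by [val]. *)
  by exists (Ordinal (ltnW k2)).
exists k, (fun i => ex (h i) \o tpar (t:=t)); split=> [i|s sI _ cons]; first exact: tpE.
have [_] := hgood s sI; apply.
have [|a Ha] := cons _ _ (@subset_refl _ _).
  apply: finite_subset (range_finite (fun j => inst (ex (h (s j))) t)) _.
  by move=> _ [j _ ->]; exists j.
by exists a => _ [j _ <-]; apply: Ha; exists j.
Qed.

End Multiplicity.

Theorem proposition2p15 (L : language) (T : set (sentence L))
    (K : Type) (M : structure L)
    (d : Order.disp_t) (O : tOrderType d)
    (AA : forall n : nat, set (ptype M n))
    (R : forall n : nat, ptype M n -> O) :
  complete_theory T -> models M T -> monster K M ->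
  well_founded (fun a b : O => (a < b)%O) ->
  type_class K AA ->
  is_rank AA R ->
  dividing_rank K AA R <-> weak_bounded_multiplicity K AA R.
Proof.
move=> _ _ [[Kunc Klim] [sf sr] Msat Mhom] _ AAcl Rk; split.
- exact: dividing_weak_bounded_multiplicity.
- exact: weak_bounded_multiplicity_dividing.
Qed.
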